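(* Let $X$ be a topological space and let $\mathcal{O}$ be the set of open covers of $X$. Then Alice has a winning strategy in $\mathsf{G}_{\mathrm{bnd}}(\mathcal{O},\mathcal{O})$ if, and only if, Alice has a winning strategy in $\mathsf{G}_1(\mathcal{O},\mathcal{O})\,\mathrm{mod}\,1$.
   Context: Here $\omega=\{0,1,2,\dots\}$. Let $\mathcal{A},\mathcal{B}$ be families of sets. The following games are played between Alice and Bob, with innings $n\in\omega$; in each inning $n$ Alice first chooses $A_n\in\mathcal{A}$ and then Bob responds with a finite $B_n\subset A_n$, each player knowing all previous moves. In $\mathsf{G}_{\mathrm{bnd}}(\mathcal{A},\mathcal{B})$, Bob wins if $\bigcup_{n\in\omega}B_n\in\mathcal{B}$ and there is a $k\in\omega$ such that $|B_n|\le k$ for every $n\in\omega$; otherwise Alice wins. In $\mathsf{G}_1(\mathcal{A},\mathcal{B})\,\mathrm{mod}\,1$, Bob wins if $\bigcup_{n\in\omega}B_n\in\mathcal{B}$ and $|B_n|\le 1$ for every $n\ge 1$ (only $B_0$ may have more than one element); otherwise Alice wins. *)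

(* Defs.v *)
From mathcomp Require Import all_boot all_order.
From mathcomp Require Import boolp classical_sets functions cardinality topology.

Set Implicit Arguments.
Unset Strict Implicit.
Unset Printing Implicit Defensive.

Local Open Scope classical_set_scope.
Local Open Scope card_scope.

Section SelectionGames.
Variable Y : Type.
Implicit Types (cA cB : set (set Y)) (b : nat -> set Y).

(* The argument is the list [:: B_0; ...; B_(n-1)] of Bob's moves before
   inning n; Alice's own earlier moves are determined by it. *)
Definition alice_strategy := seq (set Y) -> set Y.

Definition alice_move (s : alice_strategy) b (n : nat) : set Y :=
  s (mkseq b n).

Definition bob_legal (s : alice_strategy) b (n : nat) : Prop :=
  finite_set (b n) /\ b n `<=` alice_move s b n.

(* Alice has to move inside cA only as long as Bob has moved legally. *)
Definition alice_legal cA (s : alice_strategy) : Prop :=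
  forall b n, (forall m, (m < n)%N -> bob_legal s b m) ->
    cA (alice_move s b n).

(* [win b] : Bob wins the play in which his moves are b 0, b 1, ... *)
Definition alice_wins cA (win : set (nat -> set Y)) : Prop :=
  exists s : alice_strategy, alice_legal cA s /\
    forall b, (forall n, bob_legal s b n) -> ~ win b.

Definition bob_wins_bnd cB : set (nat -> set Y) :=
  [set b | cB (\bigcup_n b n) /\
           exists k : nat, forall n, b n #<= `I_k].

Definition bob_wins_1mod1 cB : set (nat -> set Y) :=
  [set b | cB (\bigcup_n b n) /\
           forall n, (1 <= n)%N -> b n #<= `I_1].

Definition alice_wins_Gbnd cA cB : Prop := alice_wins cA (bob_wins_bnd cB).

Definition alice_wins_G1mod1 cA cB : Prop := alice_wins cA (bob_wins_1mod1 cB).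

End SelectionGames.

Definition open_covers (X : topologicalType) : set (set (set X)) :=
  [set U | U `<=` open /\ cover U id = setT].

Arguments open_covers : clear implicits.

(* Main.v *)
Require Import Defs.
From mathcomp Require Import all_boot all_order.
From mathcomp Require Import boolp classical_sets functions cardinality topology.

Set Implicit Arguments.
Unset Strict Implicit.
Unset Printing Implicit Defensive.

Local Open Scope classical_set_scope.
Local Open Scope card_scope.

(** A play that Bob wins in the game with one set per inning after the first is
also a bounded play, so one implication keeps Alice's strategy.

For the converse, let [s] be winning for Alice in the game mod 1.  If [X] is
not Menger, a sequence of covers without finite selections covering [X] is
already a winning strategy in the bounded game.  Suppose that [X] is Menger.
For a finite part [F] of the first cover [s [::]], the strategy [s] goes on to
win against one set per inning on the complement [C] of the union of [F].
The argument of Pawlikowski's theorem then turns this strategy into a fixed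
sequence [U F] of covers no selection of which covers [C]
(uncovered_after_first_move, from one_selection_against):

- finitely many plays at a time are followed, Bob being allowed finitely many
  answers to each; this is a play of the Menger game, and in a Menger space Bob
  can make every point be covered in infinitely many innings, simultaneously
  along all the plays followed so far (menger_recurrent_play, a form of
  Hurewicz's theorem);
- intersecting answers from m+1 different innings gives open covers [W m].  If
  every sequence of covers had a selection covering [C], so would [W]; the m-th
  selected set can be charged to an inning not used before, and the charges fix
  a single play against [s] that covers [C].

In the bounded game Alice does not know Bob's bound [k], so she guards against
all values at once.  In inning [n], for every [m <= n], she knows a finite part
[F m] of [s [::]] whose union contains everything Bob chose before inning [m];
she plays a common refinement of [s [::]] and of n+1 fresh members of each
[U (F m)].  If Bob's bound is [k], his sets from inning [k] on shrink members
of [U (F k)] with pairwise different indices, hence do not cover the complement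
of the union of [F k], which his earlier sets do not meet. *)

(** * Finiteness and combinatorics *)

Lemma finite_uniform (I : Type) (D : set I) (P : I -> nat -> Prop) :
  finite_set D -> (forall i, D i -> exists m, P i m) ->
  (forall i m m', (m <= m')%N -> P i m -> P i m') ->
  exists m, forall i, D i -> P i m.
Proof.
move=> finD exP monoP.
have /choice[f fP] : forall i, exists m, D i -> P i m.
  by move=> i; have [/exP[m Pm]|nDi] := pselect (D i); [exists m | exists 0%N].
have [s sE] := (finite_seqP _).1 (finite_image f finD).
exists (\max_(i <- s) i)%N => i Di; apply: (monoP i (f i)); last exact: fP.
have fs : f i \in s by have : [set` s] (f i) by rewrite -sE; exists i.
exact: (@leq_bigmax_seq _ s xpredT id).
Qed.

Lemma open_finite_bigcap (X : topologicalType) (I : Type) (D : set I)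
    (F : I -> set X) :
  finite_set D -> (forall i, D i -> open (F i)) ->
  open (\bigcap_(i in D) F i).
Proof.
move=> finD opF; rewrite -closedC setC_bigcap.
apply: (@closed_bigcup X {classic I}) => // i Di.
by rewrite closedC; exact: opF.
Qed.

Lemma finite_bounded_seqs k n :
  finite_set [set t : seq nat | size t = n /\ all (leq^~ k) t].
Proof.
elim: n => [|n IH].
  apply: (@sub_finite_set _ _ [set [::]]); last exact: finite_set1.
  by move=> t [/size0nil ->].
apply: (sub_finite_set _ (finite_image2 cons (finite_II k.+1) IH)).
case=> [|a t] /= [] // [st] /andP[ak tk].
by exists a => //; exists t.
Qed.

(** Greedy choice: the m-th list is longer than the list of the m members
chosen before. *)
Lemma distinct_members (T : eqType) (ns : nat -> seq T) :
  (forall m, uniq (ns m) /\ size (ns m) = m.+1) ->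
  exists2 f : nat -> T, injective f & forall m, f m \in ns m.
Proof.
move=> nsP.
have x0 : T.
  by move: (nsP 0%N).2; case: (ns 0%N) => // x _; exact: x.
pose pick (l : seq T) m := head x0 [seq x <- ns m | x \notin l].
have pickP (l : seq T) m : (size l <= m)%N -> pick l m \in ns m /\ pick l m \notin l.
  move=> lm; have [us ss] := nsP m.
  have : has (fun x => x \notin l) (ns m).
    apply/negPn/negP => /hasPn h.
    suff : (size (ns m) <= size l)%N by rewrite ss ltnNge lm.
    by apply: uniq_leq_size => // x /h /negPn.
  rewrite has_filter /pick; case E: [seq x <- ns m | x \notin l] => [//|y s'] _ /=.
  have : y \in [seq x <- ns m | x \notin l] by rewrite E mem_head.
  by rewrite mem_filter => /andP[? ?].
pose L := fix L m := if m is m'.+1 then pick (L m') m' :: L m' else [::].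
have sL m : size (L m) = m by elim: m => //= m ->.
have subL m m' : (m < m')%N -> pick (L m) m \in L m'.
  elim: m' => // m' IH; rewrite ltnS leq_eqVlt => /orP[/eqP ->|/IH] /=.
    exact: mem_head.
  by rewrite in_cons => ->; rewrite orbT.
have fP m := pickP (L m) m (eq_leq (sL m)).
exists (fun m => pick (L m) m) => [m m' E|m]; last exact: (fP m).1.
case: (ltngtP m m') => // /subL; [rewrite E|rewrite -E] => h.
  by case: (fP m') => _; rewrite h.
by case: (fP m) => _; rewrite h.
Qed.

(** * Menger spaces *)

Definition menger (X : topologicalType) :=
  forall U : nat -> set (set X), (forall n, open_covers X (U n)) ->
  exists2 B : nat -> set (set X),
    (forall n, finite_set (B n) /\ B n `<=` U n) &
    forall x, exists n, exists2 v, B n v & v x.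

(** The Rothberger property of [C] relative to [X]: the covers are covers of the
whole space, as these are what Alice has to play. *)
Definition rothberger_on (X : topologicalType) (C : set X) :=
  forall U : nat -> set (set X), (forall n, open_covers X (U n)) ->
  exists2 u : nat -> set X, (forall n, U n (u n)) & C `<=` \bigcup_n u n.

Lemma open_coversP (X : topologicalType) (A : set (set X)) :
  open_covers X A <->
  (forall a, A a -> open a) /\ (forall x, exists2 a, A a & a x).
Proof.
split=> [[Aop Ac]|[Aop Ac]]; split=> //.
  move=> x; have : cover A id x by rewrite Ac.
  by case=> a Aa ax; exists a.
by apply/seteqP; split=> // x _; have [a Aa ax] := Ac x; exists a.
Qed.

Lemma open_covers_setT (X : topologicalType) : open_covers X [set setT].
Proof.
apply/open_coversP; split=> [a ->|x]; first exact: openT.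
by exists setT.
Qed.

Lemma menger_monotone (X : topologicalType) (W : nat -> nat -> set X) :
  menger X -> (forall n m, open (W n m)) ->
  (forall n m m', (m <= m')%N -> W n m `<=` W n m') ->
  (forall n x, exists m, W n m x) ->
  exists f : nat -> nat, forall x, exists n, W n (f n) x.
Proof.
move=> mX opW monoW covW.
have [|B BP Bcov] := mX (fun n => range (W n)).
  move=> n; apply/open_coversP; split=> [_ [m _ <-] //|x].
  by have [m Wx] := covW n x; exists (W n m) => //; exists m.
have /choice[f fP] : forall n, exists m, forall v, B n v -> v `<=` W n m.
  move=> n; have [finB subB] := BP n.
  apply: finite_uniform => // [v /subB[m _ <-]|v m m' mm' vW x /vW].
    by exists m.
  exact: monoW.
exists f => x; have [n [v Bv vx]] := Bcov x.
by exists n; exact: fP Bv _ vx.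
Qed.

(** The Menger property for a constant sequence of covers exhausts [A], up to
covering, by increasing finite parts.  These are kept nonempty so that a play
can always be prolonged inside them. *)
Lemma menger_exhaustion (X : topologicalType) (A : set (set X)) :
  menger X -> open_covers X A -> A !=set0 ->
  exists G : nat -> set (set X),
    [/\ forall m, finite_set (G m) /\ G m `<=` A, forall m, G m !=set0,
        forall m m', (m <= m')%N -> G m `<=` G m' &
        forall x, exists m, exists2 v, G m v & v x].
Proof.
move=> mX covA [a Aa].
have [//|B BP Bcov] := mX (fun=> A).
exists (fun m => a |` \bigcup_(i in `I_m.+1) B i); split.
- move=> m; split.
    rewrite finite_setU; split; first exact: finite_set1.
    apply: bigcup_finite => [|i _]; [exact: finite_II | exact: (BP i).1].
  by move=> v [->//|[i _]]; exact: (BP i).2.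
- by move=> m; exists a; left.
- move=> m m' mm' v [->|[i im Bv]]; first by left.
  by right; exists i => //=; exact: leq_trans im _.
- move=> x; have [n [v Bv vx]] := Bcov x.
  by exists n, v => //; right; exists n => /=.
Qed.

(** Hurewicz's theorem on the Menger game, where [U t m] is the set that Bob
covers when he answers [m] at position [t].  A play in which some point [x] is
covered for the last time before inning [N] is bounded by a function that
depends only on [x] and on a bound [c] for the first moves: once the moves so
far are at most [k], the next one is less than some [m] such that [x] lies in
[U t m] for the finitely many positions [t] with entries at most [k].  The
Menger property, applied once for each [c], yields a play escaping all these
bounds. *)
Lemma menger_recurrent_play (X : topologicalType) (U : seq nat -> nat -> set X) :
  menger X -> (forall t m, open (U t m)) ->
  (forall t m m', (m <= m')%N -> U t m `<=` U t m') ->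
  (forall t x, exists m, U t m x) ->
  exists f : nat -> nat,
    forall x N, exists2 n, (N <= n)%N & U (mkseq f n) (f n) x.
Proof.
move=> mX opU monoU covU.
pose bseq n k := [set t : seq nat | size t = n /\ all (leq^~ k) t].
(* W c n m : the bound of x for inning n, starting from c, is at most m. *)
pose W c := fix W n m : set X := if n is n'.+1 then
    [set x | exists k, [/\ (k <= m)%N, W n' k x &
                          forall t, bseq n k t -> U t m x]]
  else [set _ | (c <= m)%N].
have opW c n m : open (W c n m).
  elim: n m => [|n IH] m /=.
    case: (c <= m)%N.
      by rewrite (_ : mkset _ = setT); [exact: openT | apply/seteqP; split].
    by rewrite (_ : mkset _ = set0); [exact: open0 | apply/seteqP; split].
  rewrite (_ : mkset _ = \bigcup_(k in `I_m.+1)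
      (W c n k `&` \bigcap_(t in bseq n.+1 k) U t m)).
    apply: bigcup_open => k _; apply: openI; first exact: IH.
    by apply: open_finite_bigcap => //; exact: finite_bounded_seqs.
  apply/seteqP; split=> x.
    by case=> k [km Wx Ux]; exists k.
  by case=> k km [Wx Ux]; exists k.
have monoW c n m m' : (m <= m')%N -> W c n m `<=` W c n m'.
  case: n => [|n] mm' x /=; first by move=> /leq_trans; apply.
  case=> k [km Wx Ux]; exists k; split=> //; first exact: leq_trans mm'.
  by move=> t /Ux; exact: monoU.
have covW c n x : exists m, W c n m x.
  elim: n => [|n [k Wk]] /=; first by exists c.
  have [|t _||m mP] := @finite_uniform _ (bseq n.+1 k) (fun t m => U t m x).
  - exact: finite_bounded_seqs.
  - exact: covU.
  - by move=> t m m' mm'; exact: monoU.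
  exists (maxn k m), k; split=> //; first exact: leq_maxl.
  by move=> t /mP; apply: monoU; exact: leq_maxr.
(* Splitting the innings by the pairing of nat * nat serves every c. *)
have /choice[g gP] : forall c, exists g : nat -> nat,
    forall x, exists j, W c (pickle (c, j)) (g j) x.
  move=> c; apply: (@menger_monotone X (fun j => W c (pickle (c, j)))) => //.
  by move=> j; exact: monoW.
pose f n := if unpickle n is Some (c, j) then (g c j).+1 else 0%N.
exists f => x N; apply: contrapT => nex.
have late n : (N <= n)%N -> ~ U (mkseq f n) (f n) x.
  by move=> Nn Ux; apply: nex; exists n.
pose c := (\max_(i <- mkseq f N.+1) i)%N.
have fc n : (n <= N)%N -> (f n <= c)%N.
  move=> nN; apply: (@leq_bigmax_seq _ _ xpredT id (f n)) => //.
  by apply/mapP; exists n => //; rewrite mem_iota.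
(* The bounds W c n m dominate f along any play that misses x from N on. *)
have key n m : W c n m x -> (c <= m)%N /\ all (leq^~ m) (mkseq f n.+1).
  elim: n m => [|n IH] m.
    by move=> cm; split=> //=; rewrite andbT (leq_trans _ cm) // fc.
  case=> k [km /IH[ck fk] Ux].
  have cm := leq_trans ck km; split=> //.
  have fkm : all (leq^~ m) (mkseq f n.+1).
    by apply: sub_all fk => i ik; exact: leq_trans km.
  rewrite mkseqS all_rcons fkm andbT.
  have [nN|Nn] := leqP n.+1 N; first exact: leq_trans (fc _ nN) cm.
  rewrite leqNgt; apply/negP => mf; apply: (late n.+1 (ltnW Nn)).
  apply: (monoU _ _ _ (ltnW mf)); apply: Ux; split=> //.
  by rewrite size_mkseq.
have [j Wj] := gP c x; have [_] := key _ _ Wj.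
by rewrite mkseqS all_rcons {1}/f pickleK ltnn.
Qed.

(** * From strategies to sequences of covers *)

Lemma distinct_witnesses (P : nat -> Prop) :
  (forall N, exists2 n, (N <= n)%N & P n) ->
  forall m, exists ns : seq nat,
    [/\ uniq ns, size ns = m & forall n, n \in ns -> P n].
Proof.
move=> infP m.
suff [ns [N [uns sns nsP _]]] : exists ns : seq nat, exists N : nat,
    [/\ uniq ns, size ns = m, forall n, n \in ns -> P n & all (ltn^~ N) ns].
  by exists ns.
elim: m => [|m [ns [N [uns sns nsP nsN]]]]; first by exists [::], 0%N.
have [n Nn Pn] := infP N; exists (n :: ns), n.+1; split=> /=.
- rewrite uns andbT; apply/negP => /(allP nsN) /= nN.
  by rewrite leqNgt nN in Nn.
- by rewrite sns.
- by move=> i; rewrite in_cons => /orP[/eqP ->|/nsP].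
- rewrite ltnSn /=; apply: sub_all nsN => i /= iN.
  by apply: leqW; exact: leq_trans Nn.
Qed.

(** Pawlikowski's theorem: a strategy that always plays covers can be beaten on
[C] by a play in which Bob chooses exactly one set per inning. *)
Lemma one_selection_against (X : topologicalType)
    (s : seq (set X) -> set (set X)) (C : set X) :
  menger X -> rothberger_on C -> (forall p, open_covers X (s p)) ->
  exists2 b : nat -> set X, (forall n, s (mkseq b n) (b n)) &
    C `<=` \bigcup_n b n.
Proof.
move=> mX rC covs.
have ne p : s p !=set0.
  by have [//|u uP _] := rC (fun=> s p); exists (u 0%N).
have [G GP] := choice (fun p => menger_exhaustion mX (covs p) (ne p)).
have finG p m : finite_set (G p m) by case: (GP p) => /(_ m)[].
have subG p m : G p m `<=` s p by case: (GP p) => /(_ m)[].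
have neG p m : G p m !=set0 by case: (GP p).
have monoG p m m' : (m <= m')%N -> G p m `<=` G p m' by case: (GP p) => _ _ + _; exact.
have covG p x : exists m, exists2 v, G p m v & v x by case: (GP p).
have opG p m v : G p m v -> open v.
  by move=> /subG; apply: ((open_coversP _).1 (covs p)).1.
(* T t is the finite set of plays in which Bob's i-th answer belongs to the
   t_i-th part of the exhaustion of Alice's cover; U t m is what is covered by
   the next answers, whichever of these plays has taken place. *)
pose step (S : set (seq (set X))) m := \bigcup_(p in S) (rcons p @` G p m).
pose T t := foldl step [set [::]] t.
have Trcons t m : T (rcons t m) = step (T t) m by rewrite /T foldl_rcons.
have finT t : finite_set (T t).
  elim/last_ind: t => [|t m IH]; first exact: finite_set1.
  rewrite Trcons; apply: bigcup_finite => // p _; exact: finite_image.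
pose U t m := \bigcap_(p in T t) \bigcup_(v in G p m) v.
have [||t x|f fP] := @menger_recurrent_play X U mX.
- move=> t m; apply: open_finite_bigcap => // p _.
  by apply: bigcup_open => v; exact: opG.
- move=> t m m' mm' x Ux p /Ux[v Gv vx]; exists v => //; exact: monoG Gv.
- apply: (@finite_uniform _ (T t) (fun p m => (\bigcup_(v in G p m) v) x)) => //.
    by move=> p _; have [m [v Gv vx]] := covG p x; exists m, v.
  by move=> p m m' mm' [v Gv vx]; exists v => //; exact: monoG Gv.
(* A valid r prescribes an answer to every position of inning n. *)
pose Tf n := T (mkseq f n).
pose valid n (r : seq (set X) -> set X) := forall p, G p (f n) (r p).
pose W m := [set w : set X | open w /\ exists ns : seq nat,
  [/\ uniq ns, size ns = m.+1 & forall n, n \in ns ->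
     exists2 r, valid n r & forall p, Tf n p -> w `<=` r p]].
have covW m : open_covers X (W m).
  apply/open_coversP; split=> [w []//|x].
  have [ns [uns sns nsP]] := distinct_witnesses (fP x) m.+1.
  have rP n : exists r, valid n r /\ (n \in ns -> forall p, Tf n p -> r p x).
    have rP p : exists v, G p (f n) v /\ (n \in ns -> Tf n p -> v x).
      have [[nns Tp]|no] := pselect (n \in ns /\ Tf n p).
        by have [v Gv vx] := nsP n nns p Tp; exists v.
      by have [v Gv] := neG p (f n); exists v; split=> // nns Tp; case: no.
    have [r rP'] := choice rP.
    by exists r; split=> [p|nns p]; [exact: (rP' p).1 | exact: (rP' p).2].
  have [r {}rP] := choice rP.
  exists (\bigcap_(n in [set` ns]) \bigcap_(p in Tf n) r n p); last first.
    by move=> n nns p; exact: (rP n).2.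
  split.
    apply: open_finite_bigcap; first exact: finite_seq.
    move=> n _; apply: open_finite_bigcap => [|p _]; first exact: finT.
    exact: opG ((rP n).1 p).
  exists ns; split=> // n nns; exists (r n); first exact: (rP n).1.
  by move=> p Tp y /(_ n nns p Tp).
have [u uW Cu] := rC W covW.
have [ns nsP] := choice (fun m => (uW m).2).
(* g charges the m-th selected set to an inning of its own. *)
have [|g injg gns] := @distinct_members _ ns.
  by move=> m; case: (nsP m).
have RP n : exists r, valid n r /\
    forall m, g m = n -> forall p, Tf n p -> u m `<=` r p.
  have [[m gm]|no] := pselect (exists m, g m = n).
    have [_ _ /(_ n)] := nsP m; rewrite -{1}gm => /(_ (gns m))[r vr ur].
    by exists r; split=> // m' gm'; rewrite (injg m' m) // gm.
  have [r vr] := choice (fun p => neG p (f n)).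
  by exists r; split=> // m gm; case: no; exists m.
have [R {}RP] := choice RP.
(* Following the prescriptions R leads to a play that stays inside the tree,
   so the inclusions in RP apply to it. *)
pose play := fix play n := if n is n'.+1 then
  rcons (play n') (R n' (play n')) else [::].
pose b n := R n (play n).
have playE n : play n = mkseq b n by elim: n => //= n IH; rewrite mkseqS -IH.
have Tplay n : Tf n (play n).
  elim: n => [//|n IH]; rewrite /Tf mkseqS Trcons /=.
  by exists (play n) => //; exists (R n (play n)) => //; exact: (RP n).1.
exists b => [n|x /Cu[m _ ux]].
  by rewrite -playE; exact: subG ((RP n).1 _).
by exists (g m) => //; exact: (RP (g m)).2 ux.
Qed.

(** * The games *)

Lemma common_refinement (X : topologicalType) (I : Type) (D : set I)
    (U : I -> set (set X)) :
  finite_set D -> (forall i, D i -> open_covers X (U i)) ->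
  open_covers X
    [set w | open w /\ forall i, D i -> exists2 u, U i u & w `<=` u].
Proof.
move=> finD covU; apply/open_coversP; split=> [w []//|x].
have /choice[u uP] : forall i, exists u, D i -> U i u /\ u x.
  move=> i; have [Di|nDi] := pselect (D i); last by exists setT.
  by have [_ /(_ x)[v Uv vx]] := (open_coversP _).1 (covU i Di); exists v.
exists (\bigcap_(i in D) u i); last by move=> i /uP[].
split; last by move=> i Di; exists (u i); [exact: (uP i Di).1 | move=> y; exact].
apply: open_finite_bigcap => // i Di.
by apply: ((open_coversP _).1 (covU i Di)).1; exact: (uP i Di).1.
Qed.

(** Over the empty space Bob wins by choosing nothing.  Over any other space
covers are nonempty, and innings in which Bob chooses nothing can be filled. *)
Lemma alice_wins_nonempty (X : topologicalType) :
  alice_wins_G1mod1 (open_covers X) (open_covers X) -> [set: X] !=set0.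
Proof.
move=> [s [_ wins]]; apply: contrapT => noX.
have emptyX (x : X) : False by apply: noX; exists x.
apply: (wins (fun=> set0)) => [n|].
  by split; [exact: finite_set0 | exact: sub0set].
split; last by move=> n _; exact: card_ge0.
by apply/open_coversP; split=> [a [n _ []]|x]; case: (emptyX x).
Qed.

(** Otherwise Bob plays [F] in inning 0 and then beats the rest of [s] on the
complement of the union of [F]. *)
Lemma uncovered_after_first_move (X : topologicalType)
    (s : alice_strategy (set X)) (F : set (set X)) :
  menger X -> alice_legal (open_covers X) s ->
  (forall b, (forall n, bob_legal s b n) ->
     ~ bob_wins_1mod1 (open_covers X) b) ->
  finite_set F -> F `<=` s [::] ->
  ~ rothberger_on (~` \bigcup_(a in F) a).
Proof.
move=> mX legal wins finF subF rC.
pose s1 (p : seq (set X)) := s (F :: map set1 p).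
(* Outside the legal positions s need not give covers. *)
pose s1' p := if `[< open_covers X (s1 p) >] then s1 p else [set setT].
have covs1' p : open_covers X (s1' p).
  by rewrite /s1'; case: asboolP => // _; exact: open_covers_setT.
have [b bs Cb] := one_selection_against mX rC covs1'.
pose b' n := if n is n'.+1 then [set b n'] else F.
have moveS n : alice_move s b' n.+1 = s1 (mkseq b n).
  rewrite /alice_move /s1 /mkseq /= (iotaDl 1 0) -!map_comp; congr (s (F :: _)).
have s1E n : open_covers X (alice_move s b' n.+1) -> s1 (mkseq b n) (b n).
  by rewrite moveS => cov; have := bs n; rewrite /s1' asboolT.
have b'legal n : bob_legal s b' n.
  have [m] := ubnP n; elim: m n => // m IH [_|n]; first by split.
  rewrite ltnS => nm; split; first exact: finite_set1.
  move=> v ->; rewrite moveS; apply/s1E/legal => i ilt.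
  by apply: IH; exact: leq_trans nm.
have covb' n : open_covers X (alice_move s b' n) by apply: legal.
apply: (wins b') => //; split.
  apply/open_coversP; split=> [v [n _ /(b'legal n).2]|x].
    exact: ((open_coversP _).1 (covb' n)).1.
  have [[a Fa ax]|/Cb[n _ bx]] := pselect ((\bigcup_(a in F) a) x).
    by exists a => //; exists 0%N.
  by exists (b n) => //; exists n.+1.
move=> [//|n] _ /=.
by have := card_set1 (x := b n); rewrite card_eq_le => /andP[].
Qed.

Lemma alice_wins_bnd_not_menger (X : topologicalType) :
  ~ menger X -> alice_wins_Gbnd (open_covers X) (open_covers X).
Proof.
move=> nmX; apply: contrapT => nwin; apply: nmX => U covU.
apply: contrapT => noB; apply: nwin.
exists (fun h => U (size h)); split=> [b n _|b bl [covb _]]; first exact: covU.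
apply: noB; exists b.
  by move=> n; have := bl n; rewrite /bob_legal /alice_move size_mkseq.
by move=> x; have [_ /(_ x)[v [n _ bv] vx]] := (open_coversP _).1 covb; exists n, v.
Qed.

Lemma alice_wins_bnd_menger (X : topologicalType) :
  menger X -> alice_wins_G1mod1 (open_covers X) (open_covers X) ->
  alice_wins_Gbnd (open_covers X) (open_covers X).
Proof.
move=> mX win1; have [x0 _] := alice_wins_nonempty win1.
case: win1 => s [legal wins].
have covA : open_covers X (s [::]) by apply: (legal (fun=> set0) 0%N).
have ne (A : set (set X)) : open_covers X A -> A !=set0.
  by move=> /open_coversP[_ /(_ x0)[a Aa _]]; exists a.
have /choice[U UP] : forall F, exists U : nat -> set (set X),
    (forall n, open_covers X (U n)) /\
    (finite_set F -> F `<=` s [::] -> forall u, (forall n, U n (u n)) ->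
     ~ ~` (\bigcup_(a in F) a) `<=` \bigcup_n u n).
  move=> F.
  have [[finF subF]|no] := pselect (finite_set F /\ F `<=` s [::]); last first.
    exists (fun=> [set setT]); split=> [n|finF subF]; last by case: no.
    exact: open_covers_setT.
  have := uncovered_after_first_move mX legal wins finF subF.
  move=> nr; apply: contrapT => noU; apply: nr => V covV.
  apply: contrapT => nou; apply: noU; exists V; split=> // _ _ u uV Cu.
  by apply: nou; exists u.
have covU F n := (UP F).1 n.
have /choice[a aP] : forall w : set X, exists a,
    (exists2 v, s [::] v & w `<=` v) -> s [::] a /\ w `<=` a.
  move=> w; have [[v sv wv]|no] := pselect (exists2 v, s [::] v & w `<=` v).
    by exists v.
  by exists set0.
(* F b m is a finite part of s [::] refined by Bob's moves before inning m. *)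
pose F (b : nat -> set (set X)) m := a @` \bigcup_(i in `I_m) b i.
pose past (h : seq (set (set X))) := nth set0 h.
(* None stands for s [::], and Some (m, i) for the member of U (F m) with index
   pickle (n, i), which no other inning n uses. *)
pose D n : set (option (nat * nat)) :=
  None |` (Some @` (`I_n.+1 `*` `I_n.+1)).
pose V (h : seq (set (set X))) (o : option (nat * nat)) :=
  if o is Some mi then U (F (past h) mi.1) (pickle (size h, mi.2)) else s [::].
pose s' h := [set w | open w /\
  forall o, D (size h) o -> exists2 u, V h o u & w `<=` u].
have finD n : finite_set (D n).
  rewrite finite_setU; split; first exact: finite_set1.
  by apply: finite_image; apply: finite_setX; exact: finite_II.
exists s'; split=> [b n _|b bl [covb [k cardb]]].
  by apply: common_refinement => // -[mi|] _; [exact: covU | exact: covA].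
have Fpast n m : (m <= n)%N -> F (past (mkseq b n)) m = F b m.
  move=> mn; congr (_ @` _); apply: eq_bigcupr => i /= im.
  by rewrite /past nth_mkseq // (leq_trans im).
have inA n w : b n w -> s [::] (a w) /\ w `<=` a w.
  move=> bw; apply: aP; have [_ /(_ w bw)[_ wP]] := bl n.
  by apply: (wP None); left.
have inU n w m i : b n w -> (m <= n)%N -> (i <= n)%N ->
    exists2 u, U (F b m) (pickle (n, i)) u & w `<=` u.
  move=> bw mn im; have [_ /(_ w bw)[_ wP]] := bl n.
  have := wP (Some (m, i)); rewrite /V /= size_mkseq Fpast //; apply.
  by right; exists (m, i).
have /choice[g gP] : forall n, exists g : set X -> nat,
    (forall w, b n w -> (g w < k)%N) /\
    (forall w w', b n w -> b n w' -> g w = g w' -> w = w').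
  move=> n; have /pcard_leP[h] := cardb n.
  exists h; split=> [w bw|w w' bw bw']; first exact: (@funS _ _ _ _ h w bw).
  by apply: (@inj _ _ _ h); rewrite inE.
have finF : finite_set (F b k).
  apply: finite_image; apply: bigcup_finite; first exact: finite_II.
  by move=> n _; exact: (bl n).1.
have subF : F b k `<=` s [::].
  by move=> _ [w [n _ bw] <-]; exact: (inA n w bw).1.
(* The injection g n numbers Bob's sets in inning n by distinct i < k, so each
   index pickle (n, i) is asked to contain at most one of them. *)
have /choice[u uP] : forall j, exists u, U (F b k) j u /\
    forall n w, (k <= n)%N -> b n w -> j = pickle (n, g n w) -> w `<=` u.
  move=> j.
  have [[n [w [kn bw jE]]]|no] := pselect (exists n w,
      [/\ (k <= n)%N, b n w & j = pickle (n, g n w)]).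
    have [|v Uv wv] := inU n w k (g n w) bw kn.
      by apply: leq_trans kn; apply: ltnW; exact: (gP n).1.
    exists v; split=> [|n' w' _ bw']; first by rewrite jE.
    rewrite jE => /(pcan_inj pickleK)[nE]; rewrite -nE in bw' *.
    by move=> /((gP n).2 _ _ bw bw') <-.
  have [v Uv] := ne _ (covU (F b k) j); exists v; split=> // n w kn bw jE.
  by case: no; exists n, w.
apply: ((UP (F b k)).2 finF subF u) => [j|x nFx]; first exact: (uP j).1.
have [_ /(_ x)[w [n _ bw] wx]] := (open_coversP _).1 covb.
have [nk|kn] := ltnP n k.
  case: nFx; exists (a w); last exact: (inA n w bw).2.
  by exists w => //; exists n.
exists (pickle (n, g n w)) => //.
exact: (uP _).2 n w kn bw erefl _ wx.
Qed.

Theorem theorem4p13 (X : topologicalType) :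
  alice_wins_Gbnd (open_covers X) (open_covers X) <->
  alice_wins_G1mod1 (open_covers X) (open_covers X).
Proof.
split=> [[s [legal wins]]|win1].
  exists s; split=> // b bl [covb smallb]; apply: (wins b bl); split=> //.
  have [k bk] := (finite_set_leP _).1 (bl 0%N).1.
  (* k bounds the free first move, 1 all the others. *)
  exists (maxn k 1) => -[|n].
    by apply: card_le_trans bk _; rewrite card_le_II leq_maxl.
  by apply: card_le_trans (smallb n.+1 _) _ => //; rewrite card_le_II leq_maxr.
have [mX|nmX] := pselect (menger X); first exact: alice_wins_bnd_menger.
exact: alice_wins_bnd_not_menger.
Qed.
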